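(* Let $R$ be an integral domain, let $n\in\mathbb{N}\cup\{\infty\}$ and let $\mathcal{A}\in V_n(R)$ be a sequence of $2\times 2$ matrices over $R$. Then $\mathcal{A}$ is triangularizable if and only if every subsequence of $\mathcal{A}$ of length $\leq 3$ is triangularizable.
   Context: For an integral domain $R$ and $n\in\mathbb{N}\cup\{\infty\}$, $V_n(R)$ is the set of matrix sequences $\mathcal{A}=(A_1,\dots,A_n)$ (or $(A_1,A_2,\dots)$ if $n=\infty$) whose terms $A_j$ are $2\times 2$ matrices with entries in $R$. The group $G=GL_2(R)$ of invertible $2\times 2$ matrices over $R$ acts by simultaneous conjugation, $g\cdot\mathcal{A}=(gA_1g^{-1},\dots,gA_ng^{-1})$, and two sequences are similar if they lie in the same $G$-orbit. A sequence is upper triangular if all its terms are upper triangular, and triangularizable if it is similar (under $GL_2(R)$) to an upper triangular sequence. A subsequence of $\mathcal{A}$ is a sequence $(A_{j_1},\dots,A_{j_l})$ with $j_1<\dots<j_l$, obtained by deleting some of the terms of $\mathcal{A}$; $l$ is its length. *)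

(* Defs.v *)
From HB Require Import structures.
From mathcomp Require Import all_boot all_order all_algebra.
Set Implicit Arguments.
Unset Strict Implicit.
Unset Printing Implicit Defensive.
Import GRing.Theory.
Local Open Scope ring_scope.

Inductive xnat : Type := NFin of nat | NInf.

(* Positions are numbered from 0: {0, ..., m - 1} or all of nat. *)
Definition indices (n : xnat) : Type :=
  match n with NFin m => 'I_m | NInf => nat end.

Definition position (n : xnat) : indices n -> nat :=
  match n return indices n -> nat with
  | NFin m => @nat_of_ord m
  | NInf => id
  end.

Definition matseq (n : xnat) (R : idomainType) : Type := indices n -> 'M[R]_2.

Definition conj_seq (n : xnat) (R : idomainType) (g : 'M[R]_2)
    (A : matseq n R) : matseq n R :=
  fun j => g *m A j *m invmx g.

(* Sequences are functions, so they are compared termwise with =1. *)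
Definition similar (n : xnat) (R : idomainType) (A B : matseq n R) : Prop :=
  exists2 g : 'M[R]_2, g \in unitmx & B =1 conj_seq g A.

(* MathComp's is_trig_mx means lower triangular, so it is not used here. *)
Definition upper_trig_mx (R : idomainType) (M : 'M[R]_2) : Prop :=
  forall i k : 'I_2, (k < i)%N -> M i k = 0.

Definition upper_triangular (n : xnat) (R : idomainType) (A : matseq n R) :
    Prop :=
  forall j : indices n, upper_trig_mx (A j).

Definition triangularizable (n : xnat) (R : idomainType) (A : matseq n R) :
    Prop :=
  exists2 B : matseq n R, similar A B & upper_triangular B.

Definition subsequence (l : nat) (n : xnat) (R : idomainType)
    (B : matseq (NFin l) R) (A : matseq n R) : Prop :=
  exists2 s : 'I_l -> indices n,
    {homo s : i k / (i < k)%N >-> (position i < position k)%N} &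
    forall i : 'I_l, B i = A (s i).

(* Main.v *)
(** Up to conjugation, a matrix [M] is upper triangular exactly when it
    stabilises a line spanned by a unimodular vector [(x, y)], that is, when the
    binary quadratic form [det (v, M v)] vanishes at such a [v = (x, y)].  A
    nonzero binary quadratic form has at most two roots up to proportionality.
    So if no unimodular vector is a root of all the forms, pick a matrix [M] of
    which [(1, 0)] is not a root, a unimodular root [v1] of [M], a matrix [M1]
    of which [v1] is not a root, a common root [v2] of [M] and [M1], and a
    matrix [M2] of which [v2] is not a root: a common root of [M], [M1] and
    [M2] would be a third root of [M]. *)
Require Import Defs.
From mathcomp Require Import all_boot all_order all_algebra.
From mathcomp Require Import ring.
From Stdlib Require Import Classical.

Import GRing.Theory.
Local Open Scope ring_scope.

(** The determinant of the matrix with columns [v = (x, y)] and [M v]. *)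
Definition eigen_form {R : idomainType} (M : 'M[R]_2) (x y : R) : R :=
  M 1 0 * x ^+ 2 + (M 1 1 - M 0 0) * x * y - M 0 1 * y ^+ 2.

Definition unimodular_pair {R : idomainType} (x y : R) : Prop :=
  exists p q : R, p * x + q * y = 1.

Lemma mulmx2E (R : pzSemiRingType) (M N : 'M[R]_2) (i j : 'I_2) :
  (M *m N) i j = M i 0 * N 0 j + M i 1 * N 1 j.
Proof.
rewrite mxE big_ord_recl big_ord1.
by congr (_ + M i _ * N _ j); apply/val_inj.
Qed.

Lemma ord2P (i : 'I_2) : i = 0 \/ i = 1.
Proof. by case: i => [[|[|//]] lti]; [left|right]; apply/val_inj. Qed.

Lemma matrix2P (R : Type) (M N : 'M[R]_2) :
  M 0 0 = N 0 0 -> M 0 1 = N 0 1 -> M 1 0 = N 1 0 -> M 1 1 = N 1 1 -> M = N.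
Proof.
move=> e00 e01 e10 e11; apply/matrixP=> i j.
by case: (ord2P i) => ->; case: (ord2P j) => ->.
Qed.

Lemma upper_trig_mx2 (R : idomainType) (M : 'M[R]_2) :
  upper_trig_mx M <-> M 1 0 = 0.
Proof.
split=> [-> //|M10 i k].
by case: (ord2P i) => ->; case: (ord2P k) => ->.
Qed.

Lemma triangularizableP (n : xnat) (R : idomainType) (A : matseq n R) :
  triangularizable A <->
  exists x y, unimodular_pair x y /\ forall j, eigen_form (A j) x y = 0.
Proof.
split=> [[B [g g_unit BE] B_trig] | [x [y [[p [q pq1]] root_xy]]]].
  set h := invmx g; have gh1 : g *m h = 1%:M by rewrite mulmxV.
  have hg1 : h *m g = 1%:M by rewrite mulVmx.
  (* The first column of [h] spans the stable line; the first row of [g] witnesses its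
     unimodularity. *)
  exists (h 0 0), (h 1 0); split.
    exists (g 0 0), (g 0 1).
    by rewrite -mulmx2E gh1 mxE eqxx.
  move=> j; have /upper_trig_mx2 := B_trig j.
  rewrite BE /conj_seq -/h => T10.
  set T := g *m A j *m h in T10.
  have AhE : A j *m h = h *m T by rewrite /T !mulmxA hg1 mul1mx.
  have Ah i : (A j *m h) i 0 = h i 0 * T 0 0.
    by rewrite AhE mulmx2E T10 mulr0 addr0.
  have := Ah 0; have := Ah 1; rewrite !mulmx2E /eigen_form => Ah1 Ah0.
  transitivity (h 0 0 * (A j 1 0 * h 0 0 + A j 1 1 * h 1 0)
              - h 1 0 * (A j 0 0 * h 0 0 + A j 0 1 * h 1 0)); first by ring.
  by rewrite Ah0 Ah1; ring.
pose f (a b c d : R) : 'M[R]_2 :=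
  \matrix_(i, j) if i == 0 then if j == 0 then a else b
                 else if j == 0 then c else d.
(* [h] completes the column [(x, y)] to determinant [p * x + q * y = 1], and [g] is its adjugate.
   The lower left entry of [g *m A j *m h] is then [eigen_form (A j) x y]. *)
pose g := f p q (- y) x; pose h := f x (- q) y p.
have gh1 : g *m h = 1%:M.
  by apply: matrix2P; rewrite mulmx2E !mxE /= -?pq1; ring.
have g_unit : g \in unitmx by case: (mulmx1_unit gh1).
exists (conj_seq g A); first by exists g.
move=> j; apply/upper_trig_mx2; rewrite /conj_seq.
have -> : invmx g = h by rewrite -[h](mulKmx g_unit) gh1 mulmx1.
rewrite !mulmx2E !mxE /= -(root_xy j) /eigen_form.
by ring.
Qed.

(** Unimodularity of [(x', y')] makes [(x, y)] a multiple of it within [R], and the form is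
    homogeneous of degree 2. *)
Lemma eigen_form_proportional (R : idomainType) (M : 'M[R]_2) (x y x' y' : R) :
    unimodular_pair x' y' -> x * y' = x' * y -> eigen_form M x' y' = 0 ->
  eigen_form M x y = 0.
Proof.
move=> [p [q pq1]] xy' root'.
pose c := p * x + q * y.
have xE : x = c * x' by rewrite -[LHS]mulr1 -pq1 /c; ring: xy'.
have yE : y = c * y' by rewrite -[LHS]mulr1 -pq1 /c; ring: xy'.
transitivity (c ^+ 2 * eigen_form M x' y'); last by rewrite root' mulr0.
by rewrite xE yE /eigen_form; ring.
Qed.

Lemma eigen_form_three_roots (R : idomainType) (M : 'M[R]_2)
    (x1 y1 x2 y2 x3 y3 : R) :
    M 1 0 != 0 -> eigen_form M x1 y1 = 0 -> eigen_form M x2 y2 = 0 ->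
    eigen_form M x3 y3 = 0 ->
  [\/ x1 * y2 = x2 * y1, x1 * y3 = x3 * y1 | x2 * y3 = x3 * y2].
Proof.
move=> M10 r1 r2 r3.
(* The Vandermonde determinant of the vectors (x_i^2, x_i y_i, y_i^2),
   expanded by cofactors. *)
have : M 1 0 * ((x1 * y2 - x2 * y1) * (x1 * y3 - x3 * y1)
                * (x2 * y3 - x3 * y2)) = 0.
  transitivity (eigen_form M x1 y1 * (y2 * y3 * (x2 * y3 - x3 * y2))
              - eigen_form M x2 y2 * (y1 * y3 * (x1 * y3 - x3 * y1))
              + eigen_form M x3 y3 * (y1 * y2 * (x1 * y2 - x2 * y1))).
    by rewrite /eigen_form; ring.
  by rewrite r1 r2 r3 !mul0r subr0 addr0.
move/eqP; rewrite !mulf_eq0 (negPf M10) !subr_eq0 /=.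
by case/orP => [/orP[]|] /eqP; [constructor 1|constructor 2|constructor 3].
Qed.

(** Chosen indices may coincide or be out of order, while a subsequence needs strictly increasing
    positions: duplicates are removed, hence only a bound on [l]. *)
Lemma sorted_enumeration (I : eqType) (pos : I -> nat) (t : seq I) :
    injective pos ->
  exists l (s : 'I_l -> I), [/\ (l <= size t)%N,
    {homo s : i k / (i < k)%N >-> (pos i < pos k)%N} &
    forall i, i \in t -> exists k, s k = i].
Proof.
move=> pos_inj; pose u := sort (relpre pos leq) (undup t).
have su : sorted (relpre pos ltn) u.
  rewrite -sorted_map ltn_sorted_uniq_leq map_inj_uniq // sort_uniq undup_uniq.
  by rewrite sorted_map sort_sorted // => i j; apply: leq_total.
have u_sz : (size u <= size t)%N by rewrite size_sort size_undup.
exists (size u), (tnth (in_tuple u)); split=> // [i k ik | i it].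
  have lt_tr : transitive (relpre pos ltn) by move=> ? ? ?; apply: ltn_trans.
  have x0 := tnth (in_tuple u) i; rewrite !(tnth_nth x0).
  by apply: (sorted_ltn_nth lt_tr x0 su); rewrite ?inE.
have iu : i \in in_tuple u by rewrite mem_sort mem_undup.
by have /tnthP[k ->] := iu; exists k.
Qed.

Lemma subsequence_through (n : xnat) (R : idomainType) (A : matseq n R)
    (i j k : indices n) :
  exists l (B : matseq (NFin l) R), [/\ (l <= 3)%N, subsequence B A &
    [/\ exists a, B a = A i, exists a, B a = A j & exists a, B a = A k]].
Proof.
have [l [s [l3 s_homo s_surj]]] : exists l (s : 'I_l -> indices n),
    [/\ (l <= 3)%N,
        {homo s : i k / (i < k)%N >-> (position i < position k)%N} &
        [/\ exists a, s a = i, exists a, s a = j & exists a, s a = k]].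
  (* Each case makes [indices n] a concrete type with decidable equality. *)
  case: n {A} i j k => [m|] i j k /=.
    have [l [s [? ? s_surj]]] := @sorted_enumeration _ _ [:: i; j; k] (@ord_inj m).
    by exists l, s; split=> //; split; apply: s_surj; rewrite !inE eqxx ?orbT.
  have [l [s [? ? s_surj]]] := @sorted_enumeration _ _ [:: i; j; k] (@inj_id nat).
  by exists l, s; split=> //; split; apply: s_surj; rewrite !inE eqxx ?orbT.
exists l, (A \o s); split=> //; first by exists s.
by case: s_surj => [[a <-] [b <-] [c <-]]; split; [exists a|exists b|exists c].
Qed.

Theorem proposition1p9 (R : idomainType) (n : xnat) (A : matseq n R) :
  triangularizable A <->
  (forall (l : nat) (B : matseq (NFin l) R),
     (l <= 3)%N -> subsequence B A -> triangularizable B).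
Proof.
split=> [/triangularizableP[x [y [xy_uni root_xy]]] l B _ [s _ BE] | sub_trig].
  by apply/triangularizableP; exists x, y; split=> // i; rewrite BE.
have common_root i j k : exists x y, unimodular_pair x y /\
    [/\ eigen_form (A i) x y = 0, eigen_form (A j) x y = 0 &
        eigen_form (A k) x y = 0].
  have [l [B [l3 BA [[a Ba] [b Bb] [c Bc]]]]] :=
    subsequence_through n R A i j k.
  have /triangularizableP[x [y [xy_uni root_xy]]] := sub_trig l B l3 BA.
  by exists x, y; rewrite -Ba -Bb -Bc.
apply: NNPP => not_trig.
have non_root x y : unimodular_pair x y ->
    exists j, eigen_form (A j) x y <> 0.
  move=> xy_uni; apply: not_all_ex_not => root_xy.
  by apply/not_trig/triangularizableP; exists x, y.
(* At [(1, 0)] the form takes the value [M 1 0]. *)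
have [|j0 nr0] := non_root 1 0; first by exists 1, 0; ring.
have M10 : A j0 1 0 != 0.
  by apply/eqP => M10; apply: nr0; rewrite /eigen_form M10; ring.
have [x1 [y1 [uni1 [r01 _ _]]]] := common_root j0 j0 j0.
have [j1 nr1] := non_root x1 y1 uni1.
have [x2 [y2 [uni2 [r02 r12 _]]]] := common_root j0 j1 j1.
have [j2 nr2] := non_root x2 y2 uni2.
have [x3 [y3 [uni3 [r03 r13 r23]]]] := common_root j0 j1 j2.
(* Two of the three roots are proportional, so either the first is a root for [A j1] or the second
   is one for [A j2]. *)
have [e12|e13|e23] := eigen_form_three_roots R _ _ _ _ _ _ _ M10 r01 r02 r03.
- exact/nr1/(eigen_form_proportional _ _ _ _ _ _ uni2 e12 r12).
- exact/nr1/(eigen_form_proportional _ _ _ _ _ _ uni3 e13 r13).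
- exact/nr2/(eigen_form_proportional _ _ _ _ _ _ uni3 e23 r23).
Qed.
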